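(* Let $G=(V,E)$ be a tree with $|V|\ge2$, $d\ge2$, $p\in[0,1]$, and let $\rho=\bigotimes_{e\in E}\rho_e$ with $\rho_e=p\,\Phi_e+(1-p)\,\mathbb{I}_e/d^2$ be the corresponding IPEN state. Then its GME negativity is $$\mathcal{N}(\rho)=\max\{0,-\mathrm{Tr}(W_E\rho)\},\qquad W_E=-d\bigotimes_{e\in E}\Phi_e+\frac{d+1}{2}\bigotimes_{e\in E}\frac{\mathbb{I}_e+d\,\Phi_e}{d+1}.$$ In particular, $\rho$ is genuinely multipartite entangled (GME) whenever $$\Big(1-\frac{\nu_d}{d}\Big)^{|E|}>\frac{d+1}{2d},\qquad\text{where}\quad \nu_d=\frac{(d-1)(1-p)}{d-(d-1)(1-p)}.$$
   Context: Network: vertices of $G$ are parties. To each edge $e=\{u,v\}$ is attached $\mathcal{H}_e=\mathbb{C}^d\otimes\mathbb{C}^d$, one tensor factor held by $u$ and the other by $v$; the network Hilbert space is $\bigotimes_{e\in E}\mathcal{H}_e$, and each party $v$ holds all factors located at $v$. $\mathbb{I}_e$ is the identity on $\mathcal{H}_e$ and $\Phi_e=|\phi^+\rangle\langle\phi^+|$ with $|\phi^+\rangle=\frac1{\sqrt d}\sum_{i=0}^{d-1}|ii\rangle$. An IPEN (isotropic pair-entangled network) state is a state $\bigotimes_e\rho_e$ with all $\rho_e$ of the displayed form with the same visibility $p$. For $S\subseteq V$ with $S\neq\emptyset,V$ (nontrivial), $\Gamma_S$ is the partial transpose (computational basis) on all tensor factors held by parties in $S$. $\mathcal{N}_S(\sigma)$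 is the sum of absolute values of the negative eigenvalues of $\sigma^{\Gamma_S}$. The GME negativity is $\mathcal{N}(\rho)=\min\sum_S p_S\mathcal{N}_S(\rho_S)$ over all decompositions $\rho=\sum_Sp_S\rho_S$ with $S$ ranging over nontrivial subsets of $V$, $p_S\ge0$, $\rho_S\succeq0$, $\mathrm{Tr}\rho_S=1$. A state is biseparable if it is a convex mixture of states each separable with respect to some bipartition $S|V\setminus S$ of the parties; otherwise it is GME. *)

(* Defs.v *)
From mathcomp Require Import all_boot all_order all_algebra.
From mathcomp Require Import sesquilinear spectral.
From mathcomp Require Import complex.
From mathcomp Require Import reals.

Set Implicit Arguments.
Unset Strict Implicit.
Unset Printing Implicit Defensive.

Import Order.TTheory GRing.Theory Num.Theory.
Local Open Scope ring_scope.
Local Open Scope complex_scope.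
Local Open Scope sesquilinear_scope.

Section Operators.
Context {R : realType}.

(* Operators on the Hilbert space with orthonormal basis indexed by the finite
   type T; [entry A x y] is <x|A|y>. *)
Definition opmx {T : finType} (f : T -> T -> R[i]) : 'M[R[i]]_#|T| :=
  \matrix_(i, j) f (enum_val i) (enum_val j).

Definition entry {T : finType} (A : 'M[R[i]]_#|T|) (x y : T) : R[i] :=
  A (enum_rank x) (enum_rank y).

Definition ket {T : finType} (x : T) : 'cV[R[i]]_#|T| :=
  delta_mx (enum_rank x) 0.

Definition psd n (A : 'M[R[i]]_n) : Prop :=
  A \is hermsymmx /\
  forall v : 'cV[R[i]]_n, 0 <= ((v ^t*) *m A *m v) 0 0.

Definition is_state n (A : 'M[R[i]]_n) : Prop := psd A /\ \tr A = 1.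

(* Eigenvalues repeated according to their algebraic multiplicity. *)
Definition eigenvalues n (A : 'M[R[i]]_n) : seq R[i] :=
  sval (closed_field_poly_normal (char_poly A)).

(* In R[i], z < 0 holds only for (negative) real z. *)
Definition negative_part n (A : 'M[R[i]]_n) : R :=
  \sum_(z <- eigenvalues A | z < 0) complex.Re `|z|.

End Operators.

Section Edge.
Context {R : realType} (d : nat).

Definition phi_plus : 'cV[R[i]]_#|{: 'I_d * 'I_d}| :=
  (sqrtC d%:R)^-1 *: \sum_(i < d) ket (i, i).

Definition Phi : 'M[R[i]]_#|{: 'I_d * 'I_d}| := phi_plus *m phi_plus ^t*.

Definition isotropic (p : R) : 'M[R[i]]_#|{: 'I_d * 'I_d}| :=
  p%:C *: Phi + ((1 - p)%:C / d%:R ^+ 2) *: 1%:M.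

End Edge.
Arguments Phi {R} d.

Definition is_tree (V : finType) (adj : rel V) : Prop :=
  [/\ symmetric adj, irreflexive adj, (forall u v, connect adj u v)
    & forall c : seq V, ucycle adj c -> (size c <= 2)%N].

(* Each edge {u, v} is listed once, as the pair whose first component comes
   first in the enumeration of V. *)
Definition edge (V : finType) (adj : rel V) :=
  {uv : V * V | adj uv.1 uv.2 && (enum_rank uv.1 < enum_rank uv.2)%N}.

(* The two tensor factors of H_e are (e, false) and (e, true), held by the
   first and the second endpoint of e. *)
Definition factor (V : finType) (adj : rel V) := (edge adj * bool)%type.

Definition owner (V : finType) (adj : rel V) (f : factor adj) : V :=
  if f.2 then (val f.1).2 else (val f.1).1.

(* A basis vector assigns a level to each tensor factor; [local_basis] is that
   of the tensor product of the factors held by the parties in S. *)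
Definition factor_in (V : finType) (adj : rel V) (S : {set V}) :=
  {f : factor adj | owner f \in S}.

Notation net_basis adj d := {ffun factor adj -> 'I_d}.
Notation local_basis adj d S := {ffun factor_in adj S -> 'I_d}.
Notation net_op R adj d := 'M[R[i]]_#|{: net_basis adj d}|.
Notation local_op R adj d S := 'M[R[i]]_#|{: local_basis adj d S}|.

Definition nontrivial (V : finType) (S : {set V}) : bool :=
  (S != set0) && (S != setT).

Section Network.
Context {R : realType} {V : finType} {adj : rel V} {d : nat}.

Definition edge_part (x : net_basis adj d) (e : edge adj) : 'I_d * 'I_d :=
  (x (e, false), x (e, true)).

Definition edge_tensor (A : edge adj -> 'M[R[i]]_#|{: 'I_d * 'I_d}|) :
    net_op R adj d :=
  opmx (fun x y => \prod_e entry (A e) (edge_part x e) (edge_part y e)).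

Definition local_part (S : {set V}) (x : net_basis adj d) :
    local_basis adj d S :=
  [ffun f => x (val f)].

Definition cut_tensor (S : {set V})
    (A : local_op R adj d S) (B : local_op R adj d (~: S)) : net_op R adj d :=
  opmx (fun x y => entry A (local_part S x) (local_part S y)
                   * entry B (local_part (~: S) x) (local_part (~: S) y)).

(* [swap_on S x y] takes the factors held by S from y and the others from x. *)
Definition swap_on (S : {set V}) (x y : net_basis adj d) : net_basis adj d :=
  [ffun f => if owner f \in S then y f else x f].

Definition partial_transpose (S : {set V}) (A : net_op R adj d) :
    net_op R adj d :=
  opmx (fun x y => entry A (swap_on S x y) (swap_on S y x)).

Definition negativity (S : {set V}) (A : net_op R adj d) : R :=
  negative_part (partial_transpose S A).

(* sum_S p_S = 1 is not required separately: it follows from taking traces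
   when rho has trace 1. *)
Definition decomposition_value (rho : net_op R adj d) (r : R) : Prop :=
  exists (p : {set V} -> R) (sigma : {set V} -> net_op R adj d),
    [/\ forall S, nontrivial S -> 0 <= p S,
        forall S, nontrivial S -> is_state (sigma S),
        rho = \sum_(S | nontrivial S) (p S)%:C *: sigma S
      & r = \sum_(S | nontrivial S) p S * negativity S (sigma S)].

Definition is_GME_negativity (rho : net_op R adj d) (r : R) : Prop :=
  decomposition_value rho r /\
  forall r', decomposition_value rho r' -> r <= r'.

Definition separable_across (S : {set V}) (rho : net_op R adj d) : Prop :=
  exists (n : nat) (q : 'I_n -> R)
      (alpha : 'I_n -> local_op R adj d S)
      (beta : 'I_n -> local_op R adj d (~: S)),
    [/\ forall k, 0 <= q k, \sum_k q k = 1,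
        forall k, is_state (alpha k), forall k, is_state (beta k)
      & rho = \sum_k (q k)%:C *: cut_tensor (alpha k) (beta k)].

Definition biseparable (rho : net_op R adj d) : Prop :=
  exists (n : nat) (q : 'I_n -> R) (S : 'I_n -> {set V})
      (sigma : 'I_n -> net_op R adj d),
    [/\ forall k, 0 <= q k, \sum_k q k = 1, forall k, nontrivial (S k),
        forall k, separable_across (S k) (sigma k)
      & rho = \sum_k (q k)%:C *: sigma k].

Definition GME (rho : net_op R adj d) : Prop :=
  is_state rho /\ ~ biseparable rho.

End Network.

Definition ipen {R : realType} {V : finType} (adj : rel V) (d : nat) (p : R) :
    net_op R adj d :=
  edge_tensor (fun _ => isotropic d p).

Definition W_E {R : realType} {V : finType} (adj : rel V) (d : nat) :
    net_op R adj d :=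
  - (d%:R *: edge_tensor (fun _ => Phi d))
  + ((d%:R + 1) / 2) *:
    edge_tensor (fun _ => (d%:R + 1)^-1 *: (1%:M + d%:R *: Phi d)).

Definition nu {R : realType} (d : nat) (p : R) : R :=
  (d%:R - 1) * (1 - p) / (d%:R - (d%:R - 1) * (1 - p)).

(* Main.v *)
Require Import Defs.
From mathcomp Require Import all_boot all_order all_algebra.
From mathcomp Require Import sesquilinear spectral complex reals.
From mathcomp Require Import ring lra.

(** Call [Phi] and [1 - Phi] the two patterns of an edge; the IPEN state is
    diagonal in the tensor products of patterns.

    Lower bound: if [S] cuts the edge [e], split [W_E] on that edge as
    [(1 + d Phi)/2 = d Phi + (1 - d Phi)/2].  This gives [W_E = P + Q^Gamma_S]
    with [P >= 0] and [Q] the tensor product of the antisymmetric projector on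
    [e] with operators between 0 and 1, so that [0 <= Q <= 1].  Hence
    [Tr (W_E sigma) >= Tr (Q sigma^Gamma_S) >= - N_S(sigma)], and the trace is
    nonnegative when [sigma] is separable across [S].

    Upper bound: in a tree every set [K] of edges is the cut of some [S].  Let
    [Pi_K] carry [1 - Phi] exactly on [K].  Across that cut
    [Pi_K + a Pi_0] has a positive partial transpose for
    [0 <= a <= (d+1)(d-1)^(|K|-1)], since the sign of each transposed [Pi_0]
    term is compensated by one antisymmetric factor of [Pi_K].  Distributing
    the weight of [Pi_0 = Phi^(x)E] in this way leaves, by the binomial
    formula, the weight [- 2 Tr (W_E rho)/(d-1)], or nothing if this is
    negative; the remainder goes to a cut consisting of a single edge, where it
    has negativity [(d-1)/2] per unit weight. *)

Set Implicit Arguments.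
Unset Strict Implicit.
Unset Printing Implicit Defensive.

Import Order.TTheory GRing.Theory Num.Theory.
Local Open Scope ring_scope.
Local Open Scope complex_scope.
Local Open Scope sesquilinear_scope.

(** * Positive operators and negative parts *)

Lemma char_poly_conj (F : fieldType) n (P A : 'M[F]_n) :
  P \in unitmx -> char_poly (invmx P *m A *m P) = char_poly A.
Proof.
move=> Pu; rewrite /char_poly.
have -> : char_poly_mx (invmx P *m A *m P) =
    map_mx polyC (invmx P) *m char_poly_mx A *m map_mx polyC P.
  rewrite /char_poly_mx mulmxBr mulmxBl -!map_mxM mul_mx_scalar -scalemxAl.
  by rewrite -map_mxM mulVmx // map_mx1 scalemx1.
rewrite !det_mulmx mulrAC -det_mulmx -map_mxM mulVmx //.
by rewrite map_mx1 det1 mul1r.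
Qed.

Section PositiveOperators.
Context {R : realType}.
Local Notation C := R[i].

Lemma trmxC_mul m n p (A : 'M[C]_(m, n)) (B : 'M_(n, p)) :
  (A *m B)^t* = B^t* *m A^t*.
Proof. by rewrite trmx_mul map_mxM. Qed.

Lemma hermsymE n (A : 'M[C]_n) : (A \is hermsymmx) = (A^t* == A).
Proof. by rewrite is_hermitianmxE expr0 scale1r eq_sym. Qed.

Lemma psd_herm n (A : 'M[C]_n) : psd A -> A^t* = A.
Proof. by case; rewrite hermsymE => /eqP. Qed.

Lemma psd_conj m n (B : 'M[C]_(m, n)) (A : 'M[C]_m) :
  psd A -> psd (B^t* *m A *m B).
Proof.
move=> [hA pA]; split.
  by move: hA; rewrite !hermsymE !trmxC_mul trmxCK mulmxA => /eqP->.
by move=> v; have := pA (B *m v); rewrite trmxC_mul !mulmxA.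
Qed.

Lemma psd1 n : psd (1%:M : 'M[C]_n).
Proof.
split; first by rewrite hermsymE trmx1 map_mx1.
move=> v; rewrite mulmx1 mxE sumr_ge0 // => i _.
by rewrite !mxE mulrC mul_conjC_ge0.
Qed.

Lemma psd_gram m n (B : 'M[C]_(m, n)) : psd (B^t* *m B).
Proof. by have := psd_conj B (psd1 m); rewrite mulmx1. Qed.

Lemma psd_proj n (P : 'M[C]_n) : P^t* = P -> P *m P = P -> psd P.
Proof. by move=> hP PP; rewrite -PP -{1}hP; exact: psd_gram. Qed.

Lemma psdD n (A B : 'M[C]_n) : psd A -> psd B -> psd (A + B).
Proof.
move=> [hA pA] [hB pB]; split.
  move: hA hB; rewrite !hermsymE => /eqP hA /eqP hB.
  by rewrite linearD /= map_mxD hA hB.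
by move=> v; rewrite mulmxDr mulmxDl mxE addr_ge0.
Qed.

Lemma psdZ n (c : C) (A : 'M[C]_n) : 0 <= c -> psd A -> psd (c *: A).
Proof.
move=> c0 [hA pA]; split.
  move: hA; rewrite !hermsymE => /eqP hA.
  by rewrite linearZ /= map_mxZ /= hA geC0_conj.
by move=> v; rewrite -scalemxAr -scalemxAl mxE mulr_ge0.
Qed.

Lemma psd0 n : psd (0 : 'M[C]_n).
Proof. by rewrite -(scale0r 1%:M); apply/psdZ/psd1. Qed.

Lemma psd_sum n (I : Type) (r : seq I) (P : pred I) (A : I -> 'M[C]_n) :
  (forall i, P i -> psd (A i)) -> psd (\sum_(i <- r | P i) A i).
Proof. by apply: big_ind; [exact: psd0 | move=> *; exact: psdD]. Qed.

Lemma psd_diag_ge0 n (A : 'M[C]_n) i : psd A -> 0 <= A i i.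
Proof.
move=> [_ /(_ (delta_mx i 0))].
by rewrite trmx_delta map_delta_mx -rowE -colE !mxE.
Qed.

Lemma psd_tr_ge0 n (A : 'M[C]_n) : psd A -> 0 <= \tr A.
Proof. by move=> pA; apply: sumr_ge0 => i _; exact: psd_diag_ge0. Qed.

Lemma herm_spectral n (A : 'M[C]_n) : A^t* = A ->
  A = (spectralmx A)^t* *m diag_mx (spectral_diag A) *m spectralmx A.
Proof.
move=> hA; have /hermitian_normalmx/orthomx_spectralP : A \is hermsymmx.
  by rewrite hermsymE hA.
by rewrite /= invmx_unitary // spectral_unitarymx.
Qed.

Lemma spectralmx_mulC n (A : 'M[C]_n) :
  spectralmx A *m (spectralmx A)^t* = 1%:M.
Proof. by apply/unitarymxP; exact: spectral_unitarymx. Qed.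

Lemma spectralmx_Cmul n (A : 'M[C]_n) :
  (spectralmx A)^t* *m spectralmx A = 1%:M.
Proof. exact/mulmx1C/spectralmx_mulC. Qed.

Lemma spectral_diagE n (A : 'M[C]_n) : A^t* = A ->
  spectralmx A *m A *m (spectralmx A)^t* = diag_mx (spectral_diag A).
Proof.
move=> hA; rewrite {2}(herm_spectral hA) !mulmxA spectralmx_mulC mul1mx.
by rewrite -mulmxA spectralmx_mulC mulmx1.
Qed.

Lemma psd_spectral n (B A : 'M[C]_n) :
  psd B -> psd (spectralmx A *m B *m (spectralmx A)^t*).
Proof. by move=> pB; have := psd_conj (spectralmx A ^t*) pB; rewrite trmxCK. Qed.

Lemma tr_spectral n (B A : 'M[C]_n) :
  \tr (spectralmx A *m B *m (spectralmx A)^t*) = \tr B.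
Proof. by rewrite mxtrace_mulC mulmxA spectralmx_Cmul mul1mx. Qed.

(** The factor is the entrywise square root of the spectral diagonal times the unitary. This Gram
    form is how positivity passes to tensor products, transposes and traces of products. *)
Lemma psd_factor n (A : 'M[C]_n) : psd A -> exists B : 'M_n, A = B^t* *m B.
Proof.
move=> pA; have hA := psd_herm pA.
have l0 i : 0 <= spectral_diag A 0 i.
  have := psd_diag_ge0 i (psd_spectral A pA).
  by rewrite spectral_diagE // mxE eqxx mulr1n.
exists (diag_mx (\row_i sqrtC (spectral_diag A 0 i)) *m spectralmx A).
rewrite trmxC_mul tr_diag_mx map_diag_mx mulmxA -(mulmxA _ (diag_mx _)).
rewrite mulmx_diag; set D := \row_i _.
suff -> : D = spectral_diag A by exact: herm_spectral.
apply/rowP => i; rewrite !mxE /= geC0_conj ?sqrtC_ge0 //.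
by rewrite -expr2 sqrtCK.
Qed.

(** With [A = X^t* *m X], cyclicity turns the trace into that of the positive operator
    [X *m B *m X^t*]. *)
Lemma tr_mul_psd_ge0 n (A B : 'M[C]_n) : psd A -> psd B -> 0 <= \tr (A *m B).
Proof.
move=> /psd_factor[X ->] pB; rewrite -mulmxA mxtrace_mulC.
by apply: psd_tr_ge0; have := psd_conj (X^t*) pB; rewrite trmxCK.
Qed.

(** The trace of a Gram matrix is the sum of the squared moduli of the entries of its factor. *)
Lemma psd_tr_eq0 n (A : 'M[C]_n) : psd A -> \tr A = 0 -> A = 0.
Proof.
move=> /psd_factor[X ->] tr0; suff -> : X = 0 by rewrite mulmx0.
have nn i : true -> 0 <= \sum_k `|X k i| ^+ 2.
  by move=> _; apply: sumr_ge0 => k _; rewrite exprn_ge0.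
have : \sum_i \sum_k `|X k i| ^+ 2 = 0.
  rewrite -[RHS]tr0; apply: eq_bigr => i _; rewrite mxE.
  by apply: eq_bigr => k _; rewrite !mxE normCK mulrC.
move=> /(psumr_eq0P nn) h; apply/matrixP => k i; rewrite mxE.
have nk j : true -> 0 <= `|X j i| ^+ 2 by rewrite exprn_ge0.
have /eqP := psumr_eq0P nk (h i isT) (i := k) isT.
by rewrite expf_eq0 normr_eq0 => /andP[_ /eqP].
Qed.

Lemma psd_trmx n (A : 'M[C]_n) : psd A -> psd A^T.
Proof.
move=> /psd_factor[X ->]; rewrite trmx_mul.
have -> : (X^t*)^T = map_mx Num.conj X by rewrite -map_trmx trmxK.
have -> : X^T = (map_mx Num.conj X)^t*.
  by apply/matrixP => i j; rewrite !mxE /= conjCK.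
exact: psd_gram.
Qed.

(** Both lists factor the characteristic polynomial into monic linear factors, which determines them
    up to order. Negative parts can thus be computed in an orthonormal eigenbasis. *)
Lemma eigenvalues_spectral n (A : 'M[C]_n) : A^t* = A ->
  perm_eq (eigenvalues A) [seq spectral_diag A 0 i | i : 'I_n].
Proof.
move=> hA; apply: prod_XsubC_eq.
have hdiag : char_poly A = \prod_(i < n) ('X - (spectral_diag A 0 i)%:P).
  rewrite {1}(herm_spectral hA) -invmx_unitary ?spectral_unitarymx //.
  rewrite char_poly_conj ?spectral_unit // char_poly_trig ?diag_mx_is_trig //.
  by apply: eq_bigr => i _; rewrite mxE eqxx mulr1n.
rewrite big_map /= big_enum /= -hdiag /eigenvalues.
case: closed_field_poly_normal => s /= ->.
by rewrite (monicP (char_poly_monic A)) scale1r.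
Qed.

Lemma negative_partE n (A : 'M[C]_n) : A^t* = A ->
  (negative_part A)%:C =
  - \sum_(i < n | spectral_diag A 0 i < 0) spectral_diag A 0 i.
Proof.
move=> hA; rewrite /negative_part (perm_big _ (eigenvalues_spectral hA)) /=.
rewrite big_map big_enum_cond rmorph_sum -sumrN.
apply: eq_bigr => i /ltr0_norm <-; move: (normr_real (spectral_diag A 0 i)) => /RRe_real; exact.
Qed.

Lemma negative_part_ge0 n (A : 'M[C]_n) : 0 <= negative_part A.
Proof.
apply: sumr_ge0 => z _; have : 0 <= `|z| by [].
by rewrite lecE => /andP[_].
Qed.

(** In an eigenbasis of [A - B] every eigenvalue is a difference of nonnegative diagonal entries of
    [A] and [B], so a negative one has modulus at most the entry of [B]. *)
Lemma negative_part_le_tr n (A B : 'M[C]_n) : psd A -> psd B ->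
  (negative_part (A - B))%:C <= \tr B.
Proof.
move=> pA pB; set H := A - B.
have hH : H^t* = H.
  by rewrite linearB /= map_mxB (psd_herm pA) (psd_herm pB).
rewrite negative_partE // -(tr_spectral B H) /mxtrace -sumrN.
have := psd_spectral H pB; have := psd_spectral H pA.
set A' := _ *m A *m _; set B' := _ *m B *m _ => pA' pB'.
have dE i : spectral_diag H 0 i = A' i i - B' i i.
  have := spectral_diagE hH; rewrite {2}/H mulmxBr mulmxBl => /matrixP/(_ i i).
  by rewrite -/A' -/B' !mxE eqxx mulr1n.
rewrite [leRHS](bigID (fun i => spectral_diag H 0 i < 0)) /= -[leLHS]addr0.
apply: lerD; last by apply: sumr_ge0 => i _; exact: psd_diag_ge0.
apply: ler_sum => i _; rewrite dE opprB gerBl; exact: psd_diag_ge0.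
Qed.

(** In an eigenbasis of [H] the diagonal entries of [Q] lie in [0,1]: each negative eigenvalue
    contributes at least itself, each other one at least 0. *)
Lemma tr_mul_ge_negative_part n (Q H : 'M[C]_n) :
  psd Q -> psd (1%:M - Q) -> H^t* = H -> - (negative_part H)%:C <= \tr (Q *m H).
Proof.
move=> pQ pQ' hH; rewrite negative_partE // opprK.
rewrite -(tr_spectral _ H).
have -> : spectralmx H *m (Q *m H) *m (spectralmx H)^t* =
    (spectralmx H *m Q *m (spectralmx H)^t*) *m diag_mx (spectral_diag H).
  rewrite -(spectral_diagE hH) !mulmxA.
  by rewrite -(mulmxA _ _ (spectralmx H)) spectralmx_Cmul mulmx1.
have := psd_spectral H pQ; have := psd_spectral H pQ'.
rewrite mulmxBr mulmxBl mulmx1 spectralmx_mulC.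
set Q' := _ *m Q *m _ => p1 p2.
rewrite mxtrace_mulC mul_diag_mx [leRHS](bigID (fun i => spectral_diag H 0 i < 0)) /=.
rewrite -[leLHS]addr0; have q0 i := psd_diag_ge0 i p2.
have lr i : spectral_diag H 0 i \is Num.real.
  have /mxOverP -> // : spectral_diag H \is a mxOver Num.real.
  by apply: hermitian_spectral_diag_real; rewrite hermsymE hH.
apply: lerD.
  apply: ler_sum => i /ltW l0; rewrite mxE -[leLHS]mulr1 ler_wnM2l //.
  by have := psd_diag_ge0 i p1; rewrite !mxE eqxx subr_ge0.
apply: sumr_ge0 => i; rewrite mxE -real_leNgt ?real0 // => l0.
exact: mulr_ge0.
Qed.

End PositiveOperators.

(** * Tensor products over the edges *)

Section Entries.
Context {R : realType} {T : finType}.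
Local Notation C := R[i].
Implicit Types (f : T -> T -> C) (A B : 'M[C]_#|T|).

Lemma entry_opmx f x y : entry (opmx f) x y = f x y.
Proof. by rewrite /entry mxE !enum_rankK. Qed.

Lemma entryP A B : (forall x y, entry A x y = entry B x y) -> A = B.
Proof.
move=> eqAB; apply/matrixP => i j.
by have := eqAB (enum_val i) (enum_val j); rewrite /entry !enum_valK.
Qed.

Lemma entryD A B x y : entry (A + B) x y = entry A x y + entry B x y.
Proof. by rewrite /entry mxE. Qed.

Lemma entryN A x y : entry (- A) x y = - entry A x y.
Proof. by rewrite /entry mxE. Qed.

Lemma entryZ c A x y : entry (c *: A) x y = c * entry A x y.
Proof. by rewrite /entry mxE. Qed.

Lemma entry_sum (I : Type) (r : seq I) (P : pred I) (A : I -> 'M[C]_#|T|) x y :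
  entry (\sum_(i <- r | P i) A i) x y = \sum_(i <- r | P i) entry (A i) x y.
Proof. by rewrite /entry summxE. Qed.

Lemma entry1 x y : entry (1%:M : 'M[C]_#|T|) x y = (x == y)%:R.
Proof. by rewrite /entry mxE (can_eq enum_rankK). Qed.

Lemma sum_enum_rank (F : 'I_#|T| -> C) : \sum_i F i = \sum_x F (enum_rank x).
Proof.
rewrite (reindex (@enum_rank T)) //=; exists enum_val => x _.
  exact: enum_rankK.
exact: enum_valK.
Qed.

Lemma entryM A B x y : entry (A *m B) x y = \sum_z entry A x z * entry B z y.
Proof. by rewrite /entry mxE sum_enum_rank. Qed.

Lemma entry_adj A x y : entry (A^t*) x y = (entry A y x)^*%R.
Proof. by rewrite /entry !mxE. Qed.

Lemma entry_tr A : \tr A = \sum_x entry A x x.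
Proof. exact: sum_enum_rank. Qed.

End Entries.

(** * Multilinearity, traces and positivity of edge tensors *)

Section EdgeTensor.
Context {R : realType} {V : finType} {adj : rel V} {d : nat}.
Local Notation C := R[i].
Local Notation edge_op := 'M[C]_#|{: 'I_d * 'I_d}|.
Implicit Types A B : edge adj -> edge_op.

Lemma net_basisP (x y : net_basis adj d) :
  (x == y) = [forall e, edge_part x e == edge_part y e].
Proof.
apply/eqP/forallP => [-> //|eqxy]; apply/ffunP => -[e b].
by have /eqP[] := eqxy e; case: b.
Qed.

(** Distributivity: a network basis vector amounts to a choice of a pair of levels for every edge,
    and [g] and [h] translate between the two. *)
Lemma sum_net_basis (G : edge adj -> 'I_d * 'I_d -> C) :
  \sum_(x : net_basis adj d) \prod_e G e (edge_part x e) =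
  \prod_e \sum_ab G e ab.
Proof.
rewrite bigA_distr_bigA /=.
pose g (x : net_basis adj d) := [ffun e => edge_part x e].
pose h (y : {ffun edge adj -> 'I_d * 'I_d}) : net_basis adj d :=
  [ffun f => if f.2 then (y f.1).2 else (y f.1).1].
rewrite [RHS](reindex g) /=.
  by apply: eq_bigr => x _; apply: eq_bigr => e _; rewrite ffunE.
exists h => [x _|y _].
  by apply/ffunP => -[e []]; rewrite !ffunE.
by apply/ffunP => e; rewrite !ffunE /edge_part !ffunE /=; case: (y e).
Qed.

Lemma eq_edge_tensor A B : A =1 B -> edge_tensor A = edge_tensor B.
Proof.
move=> eqAB; apply: entryP => x y; rewrite !entry_opmx.
by apply: eq_bigr => e _; rewrite eqAB.
Qed.

Lemma edge_tensorM A B :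
  edge_tensor A *m edge_tensor B = edge_tensor (fun e => A e *m B e).
Proof.
apply: entryP => x y; rewrite entryM entry_opmx.
under [RHS]eq_bigr do rewrite entryM.
rewrite -sum_net_basis; apply: eq_bigr => z _.
by rewrite !entry_opmx -big_split.
Qed.

Lemma edge_tensor_adj A : (edge_tensor A)^t* = edge_tensor (fun e => (A e)^t*).
Proof.
apply: entryP => x y; rewrite entry_adj !entry_opmx rmorph_prod.
by apply: eq_bigr => e _; rewrite entry_adj.
Qed.

Lemma edge_tensor1 : edge_tensor (fun=> 1%:M) = 1%:M :> net_op R adj d.
Proof.
apply: entryP => x y; rewrite entry_opmx entry1 net_basisP.
under eq_bigr do rewrite entry1.
case: forallP => [eqxy|/forallP]; first by rewrite big1 // => e _; rewrite eqxy.
by rewrite negb_forall => /existsP[e /negbTE ne]; rewrite (bigD1 e) //= ne mul0r.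
Qed.

Lemma tr_edge_tensor A : \tr (edge_tensor A) = \prod_e \tr (A e).
Proof.
rewrite entry_tr; under [RHS]eq_bigr do rewrite entry_tr.
rewrite -sum_net_basis; apply: eq_bigr => x _; exact: entry_opmx.
Qed.

Lemma psd_edge_tensor A : (forall e, psd (A e)) -> psd (edge_tensor A).
Proof.
move=> pA; have [B AE] := fin_all_exists (fun e => psd_factor (pA e)).
rewrite (eq_edge_tensor (B := fun e => (B e)^t* *m B e)) //.
by rewrite -edge_tensorM -edge_tensor_adj; exact: psd_gram.
Qed.

Lemma edge_tensorZ (a : edge adj -> C) A :
  edge_tensor (fun e => a e *: A e) = (\prod_e a e) *: edge_tensor A.
Proof.
apply: entryP => x y; rewrite entryZ !entry_opmx -big_split /=.
by apply: eq_bigr => e _; rewrite entryZ.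
Qed.

Lemma edge_tensorD A B :
  edge_tensor (fun e => A e + B e) =
  \sum_(M : {set edge adj}) edge_tensor (fun e => if e \in M then A e else B e).
Proof.
apply: entryP => x y; rewrite entry_opmx entry_sum.
under eq_bigr do rewrite entryD.
rewrite bigA_distr /=; apply: eq_bigr => M _.
by rewrite entry_opmx; apply: eq_bigr => e _; case: ifP.
Qed.

Lemma edge_tensorD_at (e0 : edge adj) A B X :
  X e0 = A e0 + B e0 -> (forall e, e != e0 -> X e = A e /\ X e = B e) ->
  edge_tensor X = edge_tensor A + edge_tensor B.
Proof.
move=> Xe0 Xe; apply: entryP => x y; rewrite entryD !entry_opmx.
rewrite !(bigD1 (P := xpredT) e0) //= Xe0 entryD mulrDl.
by congr (_ * _ + _ * _); apply: eq_bigr => e /Xe[eA eB]; rewrite -?eA -?eB.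
Qed.

Lemma edge_tensorDZ (a b : edge adj -> C) A B :
  edge_tensor (fun e => a e *: A e + b e *: B e) =
  \sum_(M : {set edge adj}) (\prod_e if e \in M then a e else b e) *:
    edge_tensor (fun e => if e \in M then A e else B e).
Proof.
rewrite edge_tensorD; apply: eq_bigr => M _; rewrite -edge_tensorZ.
by apply: eq_edge_tensor => e; case: ifP.
Qed.

(** Expanding the sums over sets of edges, the term of the full set is [edge_tensor A]; the others
    are tensor products of positive operators. *)
Lemma psd_edge_tensorB A B : (forall e, psd (A e)) -> (forall e, psd (B e)) ->
  psd (edge_tensor (fun e => A e + B e) - edge_tensor A).
Proof.
move=> pA pB; rewrite edge_tensorD (bigD1 setT) //=.
rewrite (eq_edge_tensor (B := A)) => [|e]; last by rewrite inE.
rewrite addrAC subrr add0r; apply: psd_sum => M _; apply: psd_edge_tensor => e.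
by case: ifP.
Qed.

End EdgeTensor.

(** * Edge operators and partial transposition *)

Section EdgeOperators.
Context {R : realType} (d : nat).
Local Notation C := R[i].
Local Notation edge_op := 'M[C]_#|{: 'I_d * 'I_d}|.

Definition Phic : edge_op := 1%:M - Phi d.

(** The swap operator of the two factors of an edge, which is [d] times the partial transpose of
    [Phi]; [Psym] and [Pasym] are its eigenprojectors. *)
Definition Flip : edge_op :=
  opmx (fun x y => ((x.1 == y.2) && (x.2 == y.1))%:R).

Definition Psym : edge_op := 2^-1 *: (1%:M + Flip).

Definition Pasym : edge_op := 2^-1 *: (1%:M - Flip).

Lemma entry_Phi x y :
  entry (Phi d : edge_op) x y = (x.1 == x.2)%:R * (y.1 == y.2)%:R / d%:R.
Proof.
have phiE z : (phi_plus (R := R) d) (enum_rank z) 0 =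
    (sqrtC d%:R)^-1 * (z.1 == z.2)%:R.
  rewrite mxE summxE; congr (_ * _).
  under eq_bigr do rewrite mxE (can_eq enum_rankK) andbT.
  case: z => a b /=; have [<-|ab] := eqVneq a b.
    by rewrite (bigD1 a) //= eqxx big1 ?addr0 // => k /negbTE; rewrite xpair_eqE eq_sym => ->.
  rewrite big1 // => k _; rewrite xpair_eqE; case: eqVneq => // <-.
  by rewrite eq_sym (negbTE ab).
have sJ : ((sqrtC d%:R)^-1 : C)^*%R = (sqrtC d%:R)^-1.
  by rewrite geC0_conj // invr_ge0 sqrtC_ge0 ler0n.
have ss : (sqrtC d%:R)^-1 * (sqrtC d%:R)^-1 = d%:R^-1 :> C.
  by rewrite -invfM -expr2 sqrtCK.
move: (sqrtC d%:R)^-1 sJ ss phiE => s sJ ss; rewrite /entry /Phi.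
move: (phi_plus d) => f phiE; rewrite !mxE big_ord1 !mxE !phiE.
by rewrite rmorphM /= sJ rmorph_nat mulrACA ss mulrC.
Qed.

Lemma Phi_herm : (Phi d : edge_op)^t* = Phi d.
Proof. by rewrite /Phi trmxC_mul trmxCK. Qed.

Lemma Flip_herm : Flip^t* = Flip.
Proof.
apply: entryP => x y; rewrite entry_adj !entry_opmx rmorph_nat.
by rewrite andbC (eq_sym y.2) (eq_sym y.1).
Qed.

Lemma Flip_sqr : Flip *m Flip = 1%:M.
Proof.
apply: entryP => x y; rewrite entryM entry1 (bigD1 (x.2, x.1)) //= big1.
  rewrite !entry_opmx /= !eqxx mul1r addr0 andbC.
  by case: x y => [a b] [c e].
move=> [a b] ne; rewrite !entry_opmx /=; case: andP => [[/eqP e1 /eqP e2]|].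
  by rewrite -e1 -e2 eqxx in ne.
by rewrite mul0r.
Qed.

Lemma tr_Flip : \tr Flip = d%:R.
Proof.
rewrite entry_tr; under eq_bigr do rewrite entry_opmx.
rewrite -(pair_bigA _ (fun a b => ((a == b) && (b == a))%:R)) /=.
under eq_bigr => a _.
  rewrite (bigD1 a) //= eqxx big1 ?addr0 //.
    over.
  by move=> b /negbTE ->; rewrite andbF.
by rewrite sumr_const card_ord.
Qed.

Lemma tr_1 : \tr (1%:M : edge_op) = d%:R ^+ 2.
Proof. by rewrite mxtrace1 card_prod card_ord natrM. Qed.

Lemma half_double (n : nat) (A : 'M[C]_n) : 2^-1 *: (A + A) = A.
Proof.
by rewrite -mulr2n -(scaler_nat 2 A) scalerA mulVf ?pnatr_eq0 // scale1r.
Qed.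

Lemma Psym_Pasym : 1%:M = Psym + Pasym.
Proof. by rewrite -scalerDr addrACA subrr addr0 half_double. Qed.

Lemma Flip_Psym_Pasym : Flip = Psym - Pasym.
Proof. by rewrite -scalerBr opprB addrC addrA subrK half_double. Qed.

Lemma psd_involution n (U : 'M[C]_n) : U^t* = U -> U *m U = 1%:M ->
  psd (2^-1 *: (1%:M + U)).
Proof.
move=> hU UU; apply: psd_proj.
  by rewrite linearZ /= map_mxZ linearD /= map_mxD trmx1 map_mx1 hU fmorphV rmorph_nat.
rewrite -scalemxAl -scalemxAr mulmxDl mul1mx mulmxDr mulmx1 UU.
by rewrite [U + _]addrC half_double.
Qed.

Lemma psd_Psym : psd Psym.
Proof. exact: psd_involution Flip_herm Flip_sqr. Qed.

Lemma psd_Pasym : psd Pasym.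
Proof.
apply: psd_involution; first by rewrite linearN /= map_mxN Flip_herm.
by rewrite mulNmx mulmxN opprK Flip_sqr.
Qed.

Lemma tr_Pasym : \tr Pasym = d%:R * (d%:R - 1) / 2.
Proof. by rewrite mxtraceZ linearB /= tr_1 tr_Flip; field. Qed.

Hypothesis d_gt0 : (0 < d)%N.

Let d_neq0 : d%:R != 0 :> C. Proof. by rewrite pnatr_eq0 -lt0n. Qed.

Lemma sum_diag : \sum_(z : 'I_d * 'I_d) (z.1 == z.2)%:R = d%:R :> C.
Proof.
rewrite -(pair_bigA _ (fun a b => (a == b :> 'I_d)%:R)) /=.
under eq_bigr => a _.
  rewrite (bigD1 a) //= eqxx big1 ?addr0 //.
    over.
  by move=> b; rewrite eq_sym => /negbTE ->.
by rewrite sumr_const card_ord.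
Qed.

Lemma Phi_idem : (Phi d : edge_op) *m Phi d = Phi d.
Proof.
apply: entryP => x y; rewrite entryM.
under eq_bigr => z _ do rewrite !entry_Phi.
have -> : entry (Phi d : edge_op) x y = entry (Phi d) x y / d%:R * d%:R.
  by rewrite divfK.
rewrite -[X in _ = _ * X]sum_diag mulr_sumr; apply: eq_bigr => z _; rewrite entry_Phi.
by case: (z.1 == z.2); rewrite /=; ring.
Qed.

Lemma psd_Phi : psd (Phi d : edge_op).
Proof. exact: psd_proj Phi_herm Phi_idem. Qed.

Lemma psd_Phic : psd Phic.
Proof.
apply: psd_proj; first by rewrite linearB /= map_mxB trmx1 map_mx1 Phi_herm.
by rewrite mulmxBr mulmx1 mulmxBl mul1mx Phi_idem subrr subr0.
Qed.

Lemma Phi_Phic : (Phi d : edge_op) *m Phic = 0.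
Proof. by rewrite mulmxBr mulmx1 Phi_idem subrr. Qed.

Lemma Phic_Phi : Phic *m (Phi d : edge_op) = 0.
Proof. by rewrite mulmxBl mul1mx Phi_idem subrr. Qed.

Lemma tr_Phi : \tr (Phi d : edge_op) = 1.
Proof.
rewrite entry_tr -[RHS](mulfV d_neq0) -[X in _ = X / _]sum_diag mulr_suml.
by apply: eq_bigr => z _; rewrite entry_Phi -natrM mulnb andbb.
Qed.

Lemma tr_Phic : \tr Phic = d%:R ^+ 2 - 1.
Proof. by rewrite linearB /= tr_1 tr_Phi. Qed.

End EdgeOperators.
Arguments Phic {R} d.
Arguments Flip {R} d.
Arguments Psym {R} d.
Arguments Pasym {R} d.

Section PartialTranspose.
Context {R : realType} {V : finType} {adj : rel V} {d : nat}.
Local Notation C := R[i].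
Local Notation edge_op := 'M[C]_#|{: 'I_d * 'I_d}|.
Implicit Types (S : {set V}) (A B : net_op R adj d) (X Y : edge_op).

(** The flags tell which endpoints of the edge lie in the transposed set; with both raised this is
    the full transpose. *)
Definition edge_transpose (s1 s2 : bool) (X : edge_op) : edge_op :=
  opmx (fun x y => entry X (if s1 then y.1 else x.1, if s2 then y.2 else x.2)
                           (if s1 then x.1 else y.1, if s2 then x.2 else y.2)).

Lemma edge_transposeD s1 s2 X Y :
  edge_transpose s1 s2 (X + Y) = edge_transpose s1 s2 X + edge_transpose s1 s2 Y.
Proof. by apply: entryP => x y; rewrite entryD !entry_opmx entryD. Qed.

Lemma edge_transposeN s1 s2 X :
  edge_transpose s1 s2 (- X) = - edge_transpose s1 s2 X.
Proof. by apply: entryP => x y; rewrite entryN !entry_opmx entryN. Qed.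

Lemma edge_transposeZ s1 s2 c X :
  edge_transpose s1 s2 (c *: X) = c *: edge_transpose s1 s2 X.
Proof. by apply: entryP => x y; rewrite entryZ !entry_opmx entryZ. Qed.

Lemma edge_transpose1 s1 s2 : edge_transpose s1 s2 1%:M = 1%:M.
Proof.
apply: entryP => -[a b] [a' b']; rewrite entry_opmx !entry1 !xpair_eqE /=.
by case: s1; case: s2; rewrite // ?(eq_sym a') ?(eq_sym b').
Qed.

(** [Phi] is a symmetric matrix, so it only changes when exactly one endpoint is transposed, that
    is, on a cut edge. *)
Lemma edge_transpose_Phi s1 s2 : edge_transpose s1 s2 (Phi d) =
  if s1 != s2 then d%:R^-1 *: Flip d else Phi d.
Proof.
apply: entryP => -[a b] [a' b']; rewrite entry_opmx entry_Phi /=.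
case: s1; case: s2; rewrite /= ?entryZ ?entry_opmx ?entry_Phi /= -?natrM ?mulnb.
- by rewrite andbC.
- by rewrite mulrC andbC (eq_sym a').
- by rewrite mulrC (eq_sym a').
- by [].
Qed.

Definition cut S (e : edge adj) : bool :=
  (owner (e, false) \in S) != (owner (e, true) \in S).

Lemma partial_transpose0 S : partial_transpose S (0 : net_op R adj d) = 0.
Proof. by apply: entryP => x y; rewrite entry_opmx /entry !mxE. Qed.

Lemma partial_transposeD S A B : partial_transpose S (A + B) =
  partial_transpose S A + partial_transpose S B.
Proof. by apply: entryP => x y; rewrite entryD !entry_opmx entryD. Qed.

Lemma partial_transposeZ S c A :
  partial_transpose S (c *: A) = c *: partial_transpose S A.
Proof. by apply: entryP => x y; rewrite entryZ !entry_opmx entryZ. Qed.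

Lemma partial_transpose_sum S (I : Type) (r : seq I) (P : pred I)
    (A : I -> net_op R adj d) :
  partial_transpose S (\sum_(i <- r | P i) A i) =
  \sum_(i <- r | P i) partial_transpose S (A i).
Proof.
apply: entryP => x y; rewrite entry_opmx !entry_sum.
by apply: eq_bigr => i _; rewrite entry_opmx.
Qed.

Lemma partial_transpose_edge_tensor S (A : edge adj -> edge_op) :
  partial_transpose S (edge_tensor A) = edge_tensor (fun e =>
    edge_transpose (owner (e, false) \in S) (owner (e, true) \in S) (A e)).
Proof.
apply: entryP => x y; rewrite !entry_opmx; apply: eq_bigr => e _.
by rewrite entry_opmx /edge_part !ffunE.
Qed.

Lemma swap_onK S (x y : net_basis adj d) :
  swap_on S (swap_on S x y) (swap_on S y x) = x.
Proof. by apply/ffunP => f; rewrite !ffunE; case: (owner f \in S). Qed.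

Lemma partial_transposeK S A :
  partial_transpose S (partial_transpose S A) = A.
Proof. by apply: entryP => x y; rewrite !entry_opmx !swap_onK. Qed.

Lemma partial_transpose_herm S A :
  (partial_transpose S A)^t* = partial_transpose S (A^t*).
Proof. by apply: entryP => x y; rewrite entry_adj !entry_opmx entry_adj. Qed.

(** Exchanging the [S] parts of the two indices is an involution on pairs of basis vectors, here
    [h], which reindexes one double sum into the other. *)
Lemma tr_mul_partial_transpose S A B :
  \tr (partial_transpose S A *m B) = \tr (A *m partial_transpose S B).
Proof.
rewrite !entry_tr; under eq_bigr do rewrite entryM.
under [RHS]eq_bigr do rewrite entryM.
rewrite !pair_bigA /=.
pose h (z : net_basis adj d * net_basis adj d) :=
  (swap_on S z.1 z.2, swap_on S z.2 z.1).
rewrite [RHS](reindex h) /=.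
  by apply: eq_bigr => -[x y] _; rewrite !entry_opmx !swap_onK.
by exists h => -[x y] _; rewrite /h /= !swap_onK.
Qed.

End PartialTranspose.

(** * Cuts of a tree *)

Section Cuts.
Context {V : finType} {adj : rel V}.
Implicit Types (S : {set V}) (e : edge adj).

Definition cut_edges S : {set edge adj} := [set e | cut S e].

Lemma nontrivial_cut S :
  (exists e, e \in cut_edges S) -> nontrivial S.
Proof.
case=> e; rewrite inE /cut => h; apply/andP; split.
  by apply: contraTneq h => ->; rewrite !inE.
by apply: contraTneq h => ->; rewrite !inE.
Qed.

(** Cuts are additive modulo 2, so arbitrary cuts can be built from those with a single edge. *)
Lemma cut_xor S1 S2 e :
  cut [set x | (x \in S1) (+) (x \in S2)] e = cut S1 e (+) cut S2 e.
Proof.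
rewrite /cut !inE; move: (_ \in S1) (_ \in S1) (_ \in S2) (_ \in S2).
by do 4!case.
Qed.

Hypothesis tree_adj : is_tree adj.

Lemma edge_of_adj x y : adj x y ->
  exists e : edge adj, val e = (x, y) \/ val e = (y, x).
Proof.
move=> xy; case: tree_adj => sym irr _ _.
case: (ltngtP (enum_rank x) (enum_rank y)) => [lt|lt|/val_inj/enum_rank_inj eq].
- have h : adj (x, y).1 (x, y).2 && (enum_rank (x, y).1 < enum_rank (x, y).2)%N.
    by rewrite xy lt.
  by exists (exist _ (x, y) h); left.
- have h : adj (y, x).1 (y, x).2 && (enum_rank (y, x).1 < enum_rank (y, x).2)%N.
    by rewrite sym xy lt.
  by exists (exist _ (y, x) h); right.
- by move: xy; rewrite eq irr.
Qed.

(** If no edge were cut, [S] would be closed under adjacency, and connectedness would make it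
    everything. *)
Lemma cut_nontrivial S : nontrivial S -> exists e, cut S e.
Proof.
move=> /andP[/set0Pn[x xS] Sneq].
have /subsetPn[y _ yS] : ~~ (setT \subset S) by rewrite subTset.
apply/existsP; apply: contraNT yS => /existsPn nocut.
have clS : closed adj (mem S).
  move=> u v /edge_of_adj[e ve]; have := nocut e.
  rewrite /cut negbK /owner /=.
  by case: ve => -> /= /eqP.
case: tree_adj => _ _ /(_ x y) /(closed_connect clS) conn _.
exact: etrans (esym conn) xS.
Qed.

(** Deleting [e] from the tree separates its endpoints [u] and [v]; the component of [u] is a set
    whose only cut edge is [e]. *)
Lemma exists_single_cut (e : edge adj) :
  exists S, forall e', cut S e' = (e' == e).
Proof.
case: tree_adj => sym irr _ acyc.
pose u := (val e).1; pose v := (val e).2.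
have [auv ruv] := andP (valP e); rewrite -/u -/v in auv ruv.
pose adj' : rel V := fun x y =>
  [&& adj x y, (x, y) != (u, v) & (x, y) != (v, u)].
have sym' x y : adj' x y -> adj' y x.
  rewrite /adj' sym !xpair_eqE => /and3P[-> h1 h2] /=.
  by rewrite (andbC (y == u)) h2 (andbC (y == v)) h1.
(* A simple path from [u] to [v] avoiding the edge would close with it to a cycle. Cycles have at
   most two vertices, so the path would be the deleted edge itself. *)
have nuv : ~~ connect adj' u v.
  apply/negP => /connectP[p0 pth vE]; move: vE.
  case/shortenP: pth => p pth up _ vE.
  have pathV q z : path adj' z q -> path adj z q.
    by apply: sub_path => ? ? /and3P[].
  have : (size (u :: p) <= 2)%N.
    apply: acyc; apply/andP; split=> //.
    by rewrite /= rcons_path pathV //= -vE sym.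
  case: p pth vE {up} => [_ vE|w [] //= /andP[h _] vE _].
    by rewrite vE irr in auv.
  by move: h; rewrite -vE /adj' eqxx andbF.
exists [set x | connect adj' u x] => e'; rewrite /cut !inE /owner /=.
have [->|ne] := eqVneq e' e; first by rewrite -/u -/v connect0 (negbTE nuv).
have [axy rxy] := andP (valP e'); apply/negbTE; rewrite negbK.
have xy : adj' (val e').1 (val e').2.
  rewrite /adj' axy /=; apply/andP; split.
    apply: contraNneq ne => eqe; apply/eqP/val_inj.
    by rewrite [LHS]surjective_pairing eqe -surjective_pairing.
  (* The reversed pair is excluded because every edge is listed in enumeration order. *)
  apply: contraTneq rxy => -[-> ->]; rewrite /= -leqNgt; exact: ltnW.
apply/eqP; apply/idP/idP => h.
  exact: connect_trans h (connect1 xy).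
exact: connect_trans h (connect1 (sym' _ _ xy)).
Qed.

(** By induction on the list of edges of [K], taking the symmetric difference with a single-edge cut
    each time. *)
Lemma exists_cut (K : {set edge adj}) : exists S, cut_edges S = K.
Proof.
have single := exists_single_cut.
suff [S SE] : exists S, forall e, cut S e = (e \in enum K).
  by exists S; apply/setP => e; rewrite inE SE mem_enum.
elim: (enum K) (enum_uniq K) => [_|e s IHs /= /andP[es us]].
  by exists set0 => e; rewrite /cut !inE.
have [S1 S1E] := single e; have [S2 S2E] := IHs us.
exists [set x | (x \in S1) (+) (x \in S2)] => e'.
rewrite cut_xor S1E S2E inE; have [->|//] := eqVneq e' e.
by rewrite (negbTE es).
Qed.

End Cuts.

(** * The witness *)

Section CutTensor.
Context {R : realType} {V : finType} {adj : rel V} {d : nat}.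
Local Notation C := R[i].
Implicit Types (S : {set V}).

Lemma partial_transpose_cut_tensor S (A : local_op R adj d S)
    (B : local_op R adj d (~: S)) :
  partial_transpose S (cut_tensor A B) = cut_tensor A^T B.
Proof.
have inS (x y : net_basis adj d) : local_part S (swap_on S x y) = local_part S y.
  by apply/ffunP => f; rewrite !ffunE (valP f).
have outS (x y : net_basis adj d) :
    local_part (~: S) (swap_on S x y) = local_part (~: S) x.
  apply/ffunP => f; rewrite !ffunE; have := valP f.
  by rewrite inE => /negbTE ->.
apply: entryP => x y; rewrite !entry_opmx !inS !outS.
by rewrite /entry [A^T _ _]mxE.
Qed.

Lemma psd_cut_tensor S (A : local_op R adj d S) (B : local_op R adj d (~: S)) :
  psd A -> psd B -> psd (cut_tensor A B).
Proof.
move=> /psd_factor[X AX] /psd_factor[Y BY].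
(* The product of row [i] of [X] and row [j] of [Y], as a row over the network basis. *)
pose r i j : 'rV[C]_#|{: net_basis adj d}| :=
  \row_k (X i (enum_rank (local_part S (enum_val k))) *
          Y j (enum_rank (local_part (~: S) (enum_val k)))).
suff -> : cut_tensor A B = \sum_i \sum_j (r i j)^t* *m r i j.
  by do 2!apply: psd_sum => ? _; exact: psd_gram.
apply: entryP => x y; rewrite entry_opmx entry_sum AX BY.
rewrite /entry !mxE big_distrlr /=; apply: eq_bigr => i _.
rewrite summxE; apply: eq_bigr => j _.
by rewrite !mxE big_ord1 !mxE !enum_rankK rmorphM mulrACA.
Qed.

(** The Peres criterion: transposing the factor on [S] of a product state leaves a product of
    positive operators. *)
Lemma separable_across_psd S (rho : net_op R adj d) :
  separable_across S rho -> psd rho /\ psd (partial_transpose S rho).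
Proof.
move=> [n [q [alpha [beta [q0 _ sa sb ->]]]]]; rewrite partial_transpose_sum.
split; apply: psd_sum => k _; rewrite ?partial_transposeZ;
  (apply: psdZ; first by rewrite ler0c).
  by apply: psd_cut_tensor; [case: (sa k) | case: (sb k)].
rewrite partial_transpose_cut_tensor.
by apply: psd_cut_tensor; [apply: psd_trmx; case: (sa k) | case: (sb k)].
Qed.

End CutTensor.

(** * Decomposability of the witness and the lower bound *)

Section Witness.
Context {R : realType} {V : finType} {adj : rel V} {d : nat}.
Local Notation C := R[i].
Local Notation W := (W_E adj d : net_op R adj d).
Implicit Types (S : {set V}).
Hypotheses (tree_adj : is_tree adj) (d_gt0 : (0 < d)%N).

Let d_neq0 : d%:R != 0 :> C. Proof. by rewrite pnatr_eq0 -lt0n. Qed.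
Let d1_gt0 : 0 < d%:R + 1 :> C. Proof. by rewrite natr1 ltr0n. Qed.
Let d1_neq0 : d%:R + 1 != 0 :> C. Proof. exact: lt0r_neq0. Qed.

(** Gives the eigenvalues 1 and [(d + 1)^-1] of the second edge factor of [W_E], hence its bounds 0
    and 1. *)
Lemma Phi_Phic_mix :
  (d%:R + 1)^-1 *: (1%:M + d%:R *: Phi d) = Phi d + (d%:R + 1)^-1 *: @Phic R d.
Proof.
have -> : 1%:M + d%:R *: Phi d = (d%:R + 1) *: Phi d + @Phic R d.
  by rewrite scalerDl scale1r -addrA (addrC (Phi d)) subrK addrC.
by rewrite scalerDr scalerA mulVf // scale1r.
Qed.

Lemma W_E_decomposable S : nontrivial S -> exists P Q : net_op R adj d,
  [/\ psd P, psd Q, psd (1%:M - Q) & W = P + partial_transpose S Q].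
Proof.
move=> /(cut_nontrivial tree_adj)[e0 cut0].
(* [A] is the edge factor of the second term of [W_E]. On the cut edge, [B] has instead the operator
   whose partial transpose is [Pasym]; [P] keeps the part with [Phi] there, minus the all-[Phi]
   term. *)
pose A : 'M[C]_#|{: 'I_d * 'I_d}| := (d%:R + 1)^-1 *: (1%:M + d%:R *: Phi d).
pose B e := if e == e0 then 2^-1 *: (1%:M - d%:R *: Phi d) else A.
pose P : net_op R adj d := d%:R *: (edge_tensor (fun e =>
  Phi d + if e == e0 then 0 else (d%:R + 1)^-1 *: Phic d) -
  edge_tensor (fun=> Phi d)).
pose Q := partial_transpose S (edge_tensor B).
have pA : psd A.
  rewrite /A Phi_Phic_mix; apply: psdD; first exact: psd_Phi.
  by apply: psdZ; [rewrite invr_ge0 ltW | exact: psd_Phic].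
have pA' : psd (1%:M - A).
  rewrite /A Phi_Phic_mix opprD addrA -/(Phic d) -{1}[Phic d]scale1r -scalerBl.
  apply: psdZ; last exact: psd_Phic.
  by rewrite subr_ge0 invf_le1 // lerDr ler0n.
pose T e := edge_transpose (owner (e, false) \in S) (owner (e, true) \in S) (B e).
have TE e : T e = if e == e0 then Pasym d else
    if cut S e then (d%:R + 1)^-1 *: (2 *: Psym d) else A.
  rewrite /T /B; case: eqVneq => [->|_].
    rewrite edge_transposeZ edge_transposeD edge_transposeN edge_transposeZ.
    by rewrite edge_transpose1 edge_transpose_Phi -/(cut S e0) cut0 scalerA (mulfV d_neq0) scale1r.
  rewrite edge_transposeZ edge_transposeD edge_transposeZ.
  rewrite edge_transpose1 edge_transpose_Phi -/(cut S e); case: ifP => // _.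
  by congr (_ *: _); rewrite /Psym !scalerA !mulfV ?d_neq0 ?pnatr_eq0 // !scale1r.
have QE : Q = edge_tensor T by rewrite /Q partial_transpose_edge_tensor.
(* Each transposed factor lies between 0 and 1; on cut edges other than [e0] its norm [2 / (d + 1)]
   is at most 1 because [d] is at least 1. *)
have pT e : psd (T e) /\ psd (1%:M - T e).
  rewrite TE; case: eqVneq => _.
    by rewrite Psym_Pasym addrK; split; [exact: psd_Pasym | exact: psd_Psym].
  case: ifP => _; last by [].
  rewrite scalerA Psym_Pasym addrAC -{2}[Psym d]scale1r -scalerBl; split.
    by apply: psdZ; [rewrite mulr_ge0 // invr_ge0 ltW | exact: psd_Psym].
  apply: psdD; last exact: psd_Pasym.
  apply: psdZ; last exact: psd_Psym.
  by rewrite subr_ge0 mulrC ler_pdivrMr // mul1r natr1 (ler_nat _ 2) ltnS.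
exists P, Q; split.
- apply: psdZ; first by rewrite ler0n.
  apply: psd_edge_tensorB => e; first exact: psd_Phi.
  case: ifP => _; first exact: psd0.
  by apply: psdZ; [rewrite invr_ge0 ltW | exact: psd_Phic].
- by rewrite QE; apply: psd_edge_tensor => e; have [] := pT e.
(* The identity is the tensor product of the sums [T e + (1 - T e)], so subtracting [Q] leaves only
   positive terms. *)
- rewrite QE -edge_tensor1 (eq_edge_tensor (B := fun e => T e + (1%:M - T e))).
    by apply: psd_edge_tensorB => e; have [] := pT e.
  by move=> e; rewrite addrC subrK.
(* All edges but [e0] carry [A] on both sides, apart from the common all-[Phi] term; what remains is
   the scalar splitting on [e0]. *)
rewrite /Q partial_transposeK; apply: entryP => x y.
rewrite /W_E !(entryD, entryN, entryZ) !entry_opmx !(bigD1 e0 isT) /=.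
have rest (X Y : edge adj -> 'M[C]_#|{: 'I_d * 'I_d}|) :
    (forall e, e != e0 -> X e = Y e) ->
    \prod_(e | e != e0) entry (X e) (edge_part x e) (edge_part y e) =
    \prod_(e | e != e0) entry (Y e) (edge_part x e) (edge_part y e).
  by move=> XY; apply: eq_bigr => e /XY ->.
rewrite (rest (fun e => Phi d + if e == e0 then 0 else (d%:R + 1)^-1 *: Phic d)
  (fun=> A)); last first.
  by move=> e ne; rewrite (negbTE ne) /A Phi_Phic_mix.
rewrite (rest B (fun=> A)); last first.
  by move=> e ne; rewrite /B (negbTE ne).
rewrite -/A /B eqxx addr0 !(entryD, entryN, entryZ).
by field.
Qed.

Lemma tr_W_E_ge_negativity S (sigma : net_op R adj d) : nontrivial S ->
  psd sigma -> - (negativity S sigma)%:C <= \tr (W *m sigma).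
Proof.
move=> /W_E_decomposable[P [Q [pP pQ pQ' ->]]] ps.
rewrite mulmxDl linearD /= tr_mul_partial_transpose.
rewrite -[leLHS]add0r; apply: lerD; first exact: tr_mul_psd_ge0 pP ps.
apply: (tr_mul_ge_negative_part pQ pQ').
by rewrite partial_transpose_herm (psd_herm ps).
Qed.

Lemma tr_W_E_separable_ge0 S (sigma : net_op R adj d) : nontrivial S ->
  separable_across S sigma -> 0 <= \tr (W *m sigma).
Proof.
move=> /W_E_decomposable[P [Q [pP pQ _ ->]]] /separable_across_psd[ps ps'].
rewrite mulmxDl linearD /= tr_mul_partial_transpose.
exact: addr_ge0 (tr_mul_psd_ge0 pP ps) (tr_mul_psd_ge0 pQ ps').
Qed.

Lemma tr_W_E_biseparable_ge0 (rho : net_op R adj d) :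
  biseparable rho -> 0 <= \tr (W *m rho).
Proof.
move=> [n [q [S [sigma [q0 _ ntS sep ->]]]]].
rewrite mulmx_sumr raddf_sum; apply: sumr_ge0 => k _ /=.
rewrite -scalemxAr mxtraceZ mulr_ge0 ?ler0c //.
exact: tr_W_E_separable_ge0 (ntS k) (sep k).
Qed.

Lemma decomposition_value_ge (rho : net_op R adj d) r :
  decomposition_value rho r ->
  Num.max 0 (- complex.Re (\tr (W *m rho))) <= r.
Proof.
move=> [p [sigma [p0 st -> ->]]]; rewrite ge_max; apply/andP; split.
  by apply: sumr_ge0 => S /p0 pS; rewrite mulr_ge0 // negative_part_ge0.
set t := \tr _; set s := \sum_(_ | _) _.
suff : - s%:C <= t by rewrite lecE /= => /andP[_]; rewrite lerNl.
rewrite /s rmorph_sum -sumrN /t mulmx_sumr raddf_sum /=.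
apply: ler_sum => S ntS.
rewrite -scalemxAr mxtraceZ rmorphM /= -mulrN ler_wpM2l ?ler0c ?p0 //.
by apply: tr_W_E_ge_negativity => //; case: (st S ntS).
Qed.

End Witness.

(** * Optimal decompositions *)

Section Decomposition.
Context {R : realType} {V : finType} {adj : rel V} {d : nat}.
Local Notation C := R[i].

(** Allows unnormalised components: the weight of [tau S] is its trace, and [B S] is a correction
    restoring a positive partial transpose, whose trace bounds the negativity. *)
Lemma decomposition_of_psd (rho : net_op R adj d)
    (tau B : {set V} -> net_op R adj d) :
  is_state rho -> (forall S, psd (tau S)) -> (forall S, psd (B S)) ->
  (forall S, psd (partial_transpose S (tau S) + B S)) ->
  rho = \sum_(S | nontrivial S) tau S ->
  exists2 r, decomposition_value rho r
    & r%:C <= \sum_(S : {set V} | nontrivial S) \tr (B S).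
Proof.
move=> st ptau pB pA rhoE.
pose p S := complex.Re (\tr (tau S)).
have pE S : (p S)%:C = \tr (tau S).
  by apply: RRe_real; apply/ger0_real/psd_tr_ge0.
have p0 S : 0 <= p S by rewrite -ler0c pE psd_tr_ge0.
(* A component of trace zero vanishes, so any state may stand in for it; [rho] is at hand. *)
pose sigma S := if p S == 0 then rho else (p S)^-1%:C *: tau S.
exists (\sum_(S | nontrivial S) p S * negativity S (sigma S)).
  exists p, sigma; split=> // [S _|].
    rewrite /sigma; case: eqVneq => // pS; split.
      by apply: psdZ => //; rewrite ler0c invr_ge0.
    by rewrite mxtraceZ -pE -rmorphM mulVf.
  rewrite rhoE; apply: eq_bigr => S _; rewrite /sigma; case: eqVneq => [pS|pS].
    by rewrite pS scale0r; apply: psd_tr_eq0 => //; rewrite -pE pS.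
  by rewrite scalerA -rmorphM mulfV // scale1r.
rewrite rmorph_sum; apply: ler_sum => S _.
rewrite rmorphM /= /sigma; case: eqVneq => [->|pS].
  by rewrite mul0r psd_tr_ge0.
have c0 : 0 <= (p S)^-1%:C :> C by rewrite ler0c invr_ge0.
rewrite /negativity partial_transposeZ.
have -> : (p S)^-1%:C *: partial_transpose S (tau S) =
    (p S)^-1%:C *: (partial_transpose S (tau S) + B S) - (p S)^-1%:C *: B S.
  by rewrite -scalerBr addrK.
have le := negative_part_le_tr (psdZ c0 (pA S)) (psdZ c0 (pB S)).
apply: le_trans (ler_wpM2l _ le) _; first by rewrite ler0c.
by rewrite mxtraceZ mulrA -rmorphM mulfV // mul1r.
Qed.

End Decomposition.

(** If some [v e] is negative, a single factor with slack [k] pays for the constant [c], while the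
    other factors are dominated one by one. *)
Lemma prod_perturbation_ge0 (K : numFieldType) (I : finType) (u v : I -> K)
    (c k : K) :
  (forall e, v e \is Num.real) -> (forall e, `|v e| <= u e) -> 0 <= c <= k ->
  (forall e, 0 <= v e) \/ (exists e, k * `|v e| <= u e) ->
  0 <= \prod_e u e + c * \prod_e v e.
Proof.
move=> vr vu /andP[c0 ck]; have u0 e : 0 <= u e := le_trans (normr_ge0 _) (vu e).
case=> [v0|[e ve]].
  by rewrite addr_ge0 ?mulr_ge0 ?prodr_ge0 // => e _.
have : `|c * \prod_e v e| <= \prod_e u e.
  rewrite normrM ger0_norm // normr_prod (bigD1 e) //= [leRHS](bigD1 e) //= mulrA.
  apply: ler_pM; rewrite ?mulr_ge0 ?prodr_ge0 //.
    by apply: le_trans ve; rewrite ler_wpM2r.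
  by apply: ler_prod => e' _; rewrite normr_ge0 vu.
have cvr : c * \prod_e v e \is Num.real.
  by rewrite rpredM ?rpred_prod // ger0_real.
by rewrite real_ler_norml // => /andP[+ _]; rewrite -subr_ge0 opprK addrC.
Qed.

(** * Absorbing the weight of the all-[Phi] pattern into the other patterns *)

Section UpperBound.
Context {R : realType} {V : finType} {adj : rel V} {d : nat}.
Local Notation C := R[i].
Local Notation edge_op := 'M[C]_#|{: 'I_d * 'I_d}|.
Implicit Types (S : {set V}) (K : {set edge adj}).
Hypotheses (tree_adj : is_tree adj) (d_gt1 : (1 < d)%N).
Variables (F f : C).
Hypotheses (F_ge0 : 0 <= F) (f_ge0 : 0 <= f).

Let d_gt0 : (0 < d)%N. Proof. exact: ltnW. Qed.
Let dC_gt0 : 0 < d%:R :> C. Proof. by rewrite ltr0n. Qed.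
Let d_neq0 : d%:R != 0 :> C. Proof. exact: lt0r_neq0. Qed.
Let dB1_gt0 : 0 < d%:R - 1 :> C. Proof. by rewrite subr_gt0 (ltr_nat _ 1). Qed.
Let dV_ge0 : 0 <= d%:R^-1 :> C. Proof. by rewrite invr_ge0 ltW. Qed.
Let dB1_ge0 : 0 <= d%:R - 1 :> C. Proof. exact: ltW. Qed.
Let dB1_neq0 : d%:R - 1 != 0 :> C. Proof. exact: lt0r_neq0. Qed.

Definition Phi_pattern K : net_op R adj d :=
  edge_tensor (fun e => if e \in K then Phic d else Phi d).

(** [w K] is the weight of [Phi_pattern K] in the state, and [k * g K] is the weight of the
    all-[Phi] pattern it can absorb; [g] is a product so that its sum over [K] is a binomial
    power. *)
Let w K := \prod_e (if e \in K then f else F).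
Let g K := \prod_e (if e \in K then (d%:R - 1) * f else F).
Let k : C := (d%:R + 1) / (d%:R - 1).

Lemma psd_Phi_pattern K : psd (Phi_pattern K).
Proof.
by apply: psd_edge_tensor => e; case: ifP => _; [exact: psd_Phic | exact: psd_Phi].
Qed.

(** On a cut edge both patterns become combinations of [Psym] and [Pasym]. Uncut edges get a dummy
    second term of weight 0, so that all patterns have the same two-term shape. *)
Lemma Phi_pattern_transpose S K : partial_transpose S (Phi_pattern K) =
  edge_tensor (fun e =>
    (if e \in cut_edges S then
       if e \in K then (d%:R - 1) / d%:R else d%:R^-1
     else 1) *: (if e \in cut_edges S then Psym d
                 else if e \in K then Phic d else Phi d) +
    (if e \in cut_edges S then
       if e \in K then (d%:R + 1) / d%:R else - d%:R^-1
     else 0) *: (if e \in cut_edges S then Pasym d else Phi d)).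
Proof.
rewrite partial_transpose_edge_tensor; apply: eq_edge_tensor => e.
rewrite inE /cut.
have transPhi := edge_transpose_Phi (R := R) (d := d)
  (owner (e, false) \in S) (owner (e, true) \in S).
case: ifP transPhi => cutS transPhi; case: ifP => eK;
  rewrite /Phic ?edge_transposeD ?edge_transposeN ?edge_transpose1 transPhi.
- rewrite Flip_Psym_Pasym Psym_Pasym; move: (Psym d) (Pasym d) => X Y.
  by apply/matrixP => i j; rewrite !mxE; field.
- by rewrite Flip_Psym_Pasym scalerBr scaleNr.
- by rewrite scale0r addr0 scale1r.
- by rewrite scale0r addr0 scale1r.
Qed.

Lemma psd_ppt S K c : cut_edges S = K -> 0 <= c <= k ->
  psd (partial_transpose S (w K *: Phi_pattern K +
                            (c * g K) *: Phi_pattern set0)).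
Proof.
move=> cutS cK; rewrite partial_transposeD !partial_transposeZ.
rewrite !Phi_pattern_transpose cutS.
have -> : edge_tensor (fun e =>
      (if e \in K then if e \in K then (d%:R - 1) / d%:R else d%:R^-1 else 1) *:
        (if e \in K then Psym d else if e \in K then Phic d else Phi d) +
      (if e \in K then if e \in K then (d%:R + 1) / d%:R else - d%:R^-1 else 0)
        *: (if e \in K then Pasym d else Phi d)) =
    edge_tensor (fun e =>
      (if e \in K then (d%:R - 1) / d%:R else 1) *:
        (if e \in K then Psym d else Phi d) +
      (if e \in K then (d%:R + 1) / d%:R else 0)
        *: (if e \in K then Pasym d else Phi d)) :> net_op R adj d.
  by apply: eq_edge_tensor => e; case: (e \in K).
have -> : edge_tensor (fun e =>
      (if e \in K then if e \in set0 then (d%:R - 1) / d%:R else d%:R^-1 else 1) *: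
        (if e \in K then Psym d else if e \in set0 then Phic d else Phi d) +
      (if e \in K then if e \in set0 then (d%:R + 1) / d%:R else - d%:R^-1 else 0)
        *: (if e \in K then Pasym d else Phi d)) =
    edge_tensor (fun e =>
      (if e \in K then d%:R^-1 else 1) *:
        (if e \in K then Psym d else Phi d) +
      (if e \in K then - d%:R^-1 else 0)
        *: (if e \in K then Pasym d else Phi d)) :> net_op R adj d.
  by apply: eq_edge_tensor => e; rewrite inE.
(* Both patterns expand over the same positive operators, indexed by the set [M] of edges taking
   their first term; only scalar coefficients are left to compare. *)
rewrite !edge_tensorDZ !scaler_sumr -big_split /=; apply: psd_sum => M _.
rewrite !scalerA -scalerDl; apply: psdZ; last first.
  apply: psd_edge_tensor => e; case: ifP => _; case: ifP => _.
  - exact: psd_Psym.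
  - exact: psd_Phi.
  - exact: psd_Pasym.
  - exact: psd_Phi.
rewrite -mulrA -!big_split /=; apply: (@prod_perturbation_ge0 _ _ _ _ c k) => //.
- move=> e; have dr : d%:R \is @Num.real C by exact: realn.
  have Fr := ger0_real F_ge0; have fr := ger0_real f_ge0.
  by do 2!case: ifP => _; rewrite ?mulr0 ?mulr1 ?real0 // !rpredM ?rpredN ?rpredV ?rpredB ?real1.
- move=> e; case: ifP => eK; case: ifP => eM.
  + rewrite ger0_norm ?mulr_ge0 //.
    by rewrite mulrAC (mulrC f).
  + rewrite mulrN normrN ger0_norm ?mulr_ge0 //.
    rewrite mulrA ler_wpM2r // mulrC ler_wpM2l //.
    by rewrite lerD2l (le_trans (lerN10 _)) ?ler01.
  + by rewrite mulr1 ger0_norm.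
  + by rewrite mulr0 normr0.
(* If [M] is full, no antisymmetric factor and no sign occurs. Otherwise an edge outside [M] either
   lies in [K], where [k] is exactly the ratio of the two coefficients, or lies outside [K], where
   both vanish. *)
have [MT|/subsetPn[e _ eM]] := boolP (setT \subset M).
  left=> e; have -> : e \in M by apply: (subsetP MT).
  by case: ifP => _; rewrite ?mulr_ge0.
right; exists e; rewrite (negbTE eM); case: ifP => _.
  rewrite mulrN normrN ger0_norm ?mulr_ge0 //.
  by rewrite le_eqVlt; apply/orP; left; apply/eqP; rewrite /k; field; apply/andP.
by rewrite !mulr0 normr0 mulr0.
Qed.

(** The transposed [Phi] on [e0] is [d^-1 *: (Psym d - Pasym d)]; the added term cancels its
    negative part. *)
Lemma psd_single_cut S e0 : cut_edges S = [set e0] ->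
  psd (partial_transpose S (Phi_pattern set0) +
       edge_tensor (fun e => if e == e0 then d%:R^-1 *: Pasym d else Phi d)).
Proof.
move=> cutS; rewrite Phi_pattern_transpose cutS.
rewrite -(edge_tensorD_at (e0 := e0) (X := fun e =>
  if e == e0 then d%:R^-1 *: Psym d else Phi d)).
- apply: psd_edge_tensor => e; case: ifP => _; last exact: psd_Phi.
  exact: psdZ dV_ge0 (psd_Psym d).
- by rewrite !inE eqxx scaleNr subrK.
- by move=> e /negbTE ne; rewrite !inE ne scale1r scale0r addr0.
Qed.

Lemma tr_single_cut (e0 : edge adj) :
  \tr (edge_tensor (fun e => if e == e0 then d%:R^-1 *: Pasym d else Phi d)) =
  (d%:R - 1) / 2 :> C.
Proof.
rewrite tr_edge_tensor (bigD1 e0) //= eqxx big1 => [|e /negbTE ->].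
  by rewrite mulr1 mxtraceZ tr_Pasym !mulrA mulVf // mul1r.
exact: tr_Phi.
Qed.

(** [t] is the fraction used of the total absorbing capacity and [x] the weight left over, which is
    put on the cut [[set e0]] at the cost [(d - 1) / 2] per unit. *)
Lemma isotropic_product_decomposition (rho : net_op R adj d) (t x : C)
    (e0 : edge adj) : let m := #|{: edge adj}| in
  rho = edge_tensor (fun=> F *: Phi d + f *: Phic d) -> is_state rho ->
  0 <= t <= 1 -> 0 <= x ->
  F ^+ m = t * (k * ((F + (d%:R - 1) * f) ^+ m - F ^+ m)) + x ->
  exists2 r, decomposition_value rho r & r%:C <= x * ((d%:R - 1) / 2).
Proof.
move=> m rhoE st /andP[t0 t1] x0 FE.
have k0 : 0 <= k by rewrite divr_ge0 // addr_ge0 // ltW.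
have [Sof SofK] := fin_all_exists (exists_cut tree_adj).
pose T K := w K *: Phi_pattern K + (t * k * g K) *: Phi_pattern set0 +
  (if K == [set e0] then x else 0) *: Phi_pattern set0.
pose cE S : {set edge adj} := cut_edges S.
(* Different sets can have the same cut; only the representative [Sof K] carries the component of
   [K]. *)
pose chosen S := (Sof (cE S) == S) && (cE S != set0).
pose tau S := if chosen S then T (cE S) else 0.
pose B0 : net_op R adj d :=
  edge_tensor (fun e => if e == e0 then d%:R^-1 *: Pasym d else Phi d).
pose B S := if S == Sof [set e0] then x *: B0 else 0.
have tk : 0 <= t * k <= k by rewrite mulr_ge0 //= ler_piMl.
have w0 K : 0 <= w K by apply: prodr_ge0 => e _; case: ifP.
have g0 K : 0 <= g K.
  by apply: prodr_ge0 => e _; case: ifP => // _; rewrite mulr_ge0.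
have pB0 : psd B0.
  apply: psd_edge_tensor => e; case: ifP => _; last exact: psd_Phi.
  by apply: psdZ; [exact: dV_ge0 | exact: psd_Pasym].
have -> : x * ((d%:R - 1) / 2) = \sum_(S : {set V} | nontrivial S) \tr (B S).
  rewrite (bigD1 (Sof [set e0])) /=; last first.
    by apply: nontrivial_cut; exists e0; rewrite SofK inE.
  rewrite big1 => [|S /andP[_ /negbTE ne]]; last by rewrite /B ne mxtrace0.
  by rewrite addr0 /B eqxx mxtraceZ tr_single_cut.
apply: (decomposition_of_psd (tau := tau)) => [|S|S|S|]; first exact: st.
- rewrite /tau; case: ifP => _; last exact: psd0.
  have pP K c : 0 <= c -> psd (c *: Phi_pattern K).
    by move=> c0; exact: psdZ c0 (psd_Phi_pattern K).
  apply: psdD; last by apply: pP; case: ifP.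
  apply: psdD; apply: pP; first exact: w0.
  by rewrite mulr_ge0 // mulr_ge0.
- by rewrite /B; case: ifP => _; [exact: psdZ x0 pB0 | exact: psd0].
- rewrite /tau /B /chosen /cE; have [->|ne] := eqVneq S (Sof [set e0]).
    rewrite SofK eqxx /= (_ : [set e0] != set0); last first.
      by apply/set0Pn; exists e0; rewrite inE.
    rewrite partial_transposeD -addrA; apply: psdD.
      exact: (psd_ppt (SofK _) tk).
    rewrite eqxx partial_transposeZ -scalerDr.
    exact: psdZ x0 (psd_single_cut (SofK _)).
  rewrite addr0; case: ifP => [/andP[/eqP SE _]|_]; last first.
    by rewrite partial_transpose0; exact: psd0.
  rewrite /T (_ : cut_edges S == [set e0] = false); last first.
    by apply/negbTE; apply: contraNneq ne => <-; rewrite SE.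
  by rewrite scale0r addr0; exact: (psd_ppt (erefl _) tk).
have -> : \sum_(S | nontrivial S) tau S = \sum_(K | K != set0) T K.
  rewrite /tau -big_mkcondr (reindex_onto Sof cE) /=.
    apply: eq_big => K; rewrite /chosen /cE SofK //.
    rewrite !eqxx !andbT.
    apply/andb_idl => /set0Pn[e eK]; apply: nontrivial_cut.
    by exists e; rewrite SofK.
  by move=> S /andP[_ /andP[/eqP]].
rewrite rhoE.
rewrite (eq_edge_tensor (B := fun e => f *: Phic d + F *: Phi d)) => [|e]; last first.
  by rewrite addrC.
(* The term of the empty set, the all-[Phi] pattern of weight [F ^+ m], is isolated: it has to equal
   the sum of the shares given to the other patterns. *)
rewrite edge_tensorDZ -/(Phi_pattern _) (bigD1 set0) //= addrC.
have w_set0 : w set0 = F ^+ m.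
  by rewrite /w -prodr_const; apply: eq_bigr => e _; rewrite inE.
have g_set0 : g set0 = F ^+ m.
  by rewrite /g -prodr_const; apply: eq_bigr => e _; rewrite inE.
rewrite !big_split /= -!addrA; congr (_ + _).
rewrite -!scaler_suml -scalerDl -/(w set0) w_set0; congr (_ *: _).
rewrite [in LHS]FE; congr (_ + _).
  rewrite -mulr_sumr -mulrA; congr (_ * (_ * _)).
  have -> : (F + (d%:R - 1) * f) ^+ m = \sum_K g K.
    rewrite /m -prodr_const addrC.
    by rewrite (bigA_distr _ _ (fun=> (d%:R - 1) * f) (fun=> F)).
  by rewrite (bigD1 set0) //= g_set0 addrAC subrr add0r.
rewrite (bigD1 [set e0]) /=; last by apply/set0Pn; exists e0; rewrite inE.
by rewrite eqxx big1 ?addr0 // => K /andP[_ /negbTE ->].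
Qed.

End UpperBound.

(** * The IPEN state *)

Section IPEN.
Context {R : realType} {V : finType} {adj : rel V} {d : nat} (p : R).
Local Notation C := R[i].
Local Notation m := #|{: edge adj}|.
Hypotheses (d_gt1 : (1 < d)%N) (p_range : 0 <= p <= 1).

Let d_gt0 : (0 < d)%N. Proof. exact: ltnW. Qed.
Let dC_neq0 : d%:R != 0 :> C. Proof. by rewrite pnatr_eq0 -lt0n. Qed.
Let dC1_neq0 : d%:R + 1 != 0 :> C. Proof. by rewrite natr1 pnatr_eq0. Qed.

(** [noise] and [fidelity] are the weights of [Phic] and [Phi] in the edge state. *)
Definition noise : C := (1 - p)%:C / d%:R ^+ 2.

Definition fidelity : C := p%:C + noise.

Lemma noise_ge0 : 0 <= noise.
Proof.
by rewrite divr_ge0 ?exprn_ge0 ?ler0n // ler0c subr_ge0; case/andP: p_range.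
Qed.

Lemma fidelity_ge0 : 0 <= fidelity.
Proof. by rewrite addr_ge0 ?noise_ge0 // ler0c; case/andP: p_range. Qed.

Lemma isotropicE : isotropic d p = fidelity *: Phi d + noise *: Phic d.
Proof.
by rewrite /isotropic -/noise scalerBr /fidelity scalerDl -addrA (addrC (_ *: Phi d) (_ - _)) subrK.
Qed.

Lemma tr_isotropic : \tr (isotropic d p) = 1 :> C.
Proof.
rewrite isotropicE linearD /= !mxtraceZ tr_Phi // tr_Phic // mulr1.
have -> : fidelity + noise * (d%:R ^+ 2 - 1) = p%:C + noise * d%:R ^+ 2.
  by rewrite /fidelity; ring.
by rewrite divfK ?expf_neq0 // -rmorphD addrC subrK.
Qed.

Lemma ipen_state : is_state (ipen adj d p).
Proof.
split; last by rewrite tr_edge_tensor big1 // => e _; exact: tr_isotropic.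
apply: psd_edge_tensor => e; rewrite isotropicE; apply: psdD.
  exact: psdZ fidelity_ge0 (psd_Phi d_gt0).
exact: psdZ noise_ge0 (psd_Phic d_gt0).
Qed.

Lemma tr_W_E_ipen : \tr (W_E adj d *m ipen adj d p) =
  - (d%:R * fidelity ^+ m) +
  (d%:R + 1) / 2 * (fidelity + (d%:R - 1) * noise) ^+ m.
Proof.
(* Both edge factors of the witness have this form, with [a] equal to 0 or [(d + 1)^-1]; the latter
   gives the factor [d - 1]. *)
have tr_prod (a : C) : \tr ((Phi d + a *: Phic d) *m isotropic d p) =
    fidelity + a * (d%:R ^+ 2 - 1) * noise.
  rewrite isotropicE mulmxDl !mulmxDr -!scalemxAr -!scalemxAl Phi_idem //.
  rewrite Phi_Phic // Phic_Phi // !scaler0 addr0 add0r.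
  have -> : @Phic R d *m Phic d = Phic d.
    by rewrite {1}/Phic mulmxBl mul1mx Phi_Phic // subr0.
  by rewrite linearD /= !mxtraceZ tr_Phi // tr_Phic // mulr1; ring.
rewrite mulmxDl mulNmx -!scalemxAl linearD linearN /= !mxtraceZ.
rewrite /ipen !edge_tensorM !tr_edge_tensor !prodr_const.
rewrite Phi_Phic_mix tr_prod -[Phi d]addr0 -(scale0r (Phic d)) tr_prod.
by rewrite !mul0r addr0; congr (_ + _ * _ ^+ _); field.
Qed.

End IPEN.
Arguments noise {R} d p.
Arguments fidelity {R} d p.

(** [H] is [fidelity + (d - 1) * noise], the base of the second power in the trace of the witness,
    so the visibility criterion says that this trace is negative. *)
Lemma visibility_ratio (R : realType) (d : nat) (p : R) : (1 < d)%N -> 0 <= p <= 1 ->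
  let H := p + (1 - p) / d%:R in
  0 < H /\ 1 - nu d p / d%:R = (p + (1 - p) / d%:R ^+ 2) / H.
Proof.
move=> d1 /andP[p0 p1] H.
have d0 : 0 < d%:R :> R by rewrite ltr0n ltnW.
have den : 0 < d%:R - (d%:R - 1) * (1 - p) :> R.
  have d1' : 1 < d%:R :> R by rewrite (ltr_nat _ 1).
  by nra.
have HE : H = (d%:R - (d%:R - 1) * (1 - p)) / d%:R.
  by rewrite /H; field; rewrite lt0r_neq0.
split; first by rewrite HE divr_gt0.
rewrite HE /nu; field.
by rewrite !lt0r_neq0.
Qed.

Theorem mainTheorem7 (R : realType) (V : finType) (adj : rel V) (d : nat) (p : R)
    (tree_adj : is_tree adj) (card_V : (2 <= #|V|)%N) (d_ge2 : (2 <= d)%N)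
    (p_range : 0 <= p <= 1) :
  is_GME_negativity (ipen adj d p)
    (Num.max 0 (- complex.Re (\tr (W_E adj d *m ipen adj d p))))
  /\ ((d%:R + 1) / (2 * d%:R) < (1 - nu d p / d%:R) ^+ #|{: edge adj}| ->
      GME (ipen adj d p)).
Proof.
have d_gt0 : (0 < d)%N by exact: ltnW.
have st := ipen_state (adj := adj) d_ge2 p_range.
have F0 := fidelity_ge0 (d := d) p_range; have f0 := noise_ge0 (d := d) p_range.
have rhoE : ipen adj d p =
    edge_tensor (fun=> fidelity d p *: Phi d + noise d p *: Phic d).
  by apply: eq_edge_tensor => e; exact: isotropicE.
have trE := tr_W_E_ipen (adj := adj) p d_ge2.
have dB1_gt0 : 0 < d%:R - 1 :> R[i] by rewrite subr_gt0 (ltr_nat _ 1).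
have dB1_neq0 := lt0r_neq0 dB1_gt0.
have [x [y [_ _ xy]]] := card_gt1P card_V.
(* With two vertices a singleton is nontrivial and, by connectedness, cuts an edge. *)
have [e0 _] : exists e0 : edge adj, cut [set x] e0.
  apply: cut_nontrivial => //; apply/andP; split.
    by apply/set0Pn; exists x; rewrite inE.
  by apply: contraNneq xy => xT; rewrite eq_sym -in_set1 xT inE.
split; last first.
  move=> visible; split=> // /(tr_W_E_biseparable_ge0 tree_adj d_gt0).
  have [H0 nuE] := visibility_ratio d_ge2 p_range.
  have dR : 0 < d%:R :> R by rewrite ltr0n.
  rewrite nuE expr_div_n ltr_pdivlMr ?exprn_gt0 // in visible.
  have FE : fidelity d p = (p + (1 - p) / d%:R ^+ 2)%:C.
    rewrite /fidelity /noise [RHS]rmorphD [X in _ = _ + X]rmorphM fmorphV.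
    by rewrite rmorphXn rmorph_nat.
  have HE : fidelity d p + (d%:R - 1) * noise d p = (p + (1 - p) / d%:R)%:C.
    rewrite /fidelity /noise [RHS]rmorphD [X in _ = _ + X]rmorphM fmorphV.
    rewrite rmorph_nat /=.
    by field; rewrite pnatr_eq0 -lt0n.
  set Fr := p + (1 - p) / d%:R ^+ 2 in FE visible.
  set Hr := p + (1 - p) / d%:R in HE H0 visible.
  clearbody Fr Hr; set m := #|{: edge adj}| in trE visible.
  have -> : \tr (W_E adj d *m ipen adj d p) =
      (- (d%:R * Fr ^+ m) + (d%:R + 1) / 2 * Hr ^+ m)%:C.
    rewrite trE HE FE [RHS]rmorphD rmorphN !rmorphM fmorphV rmorphD !rmorphXn.
    by rewrite !rmorph_nat rmorph1.
  rewrite ler0c addrC subr_ge0 leNgt => /negP; apply.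
  have -> : (d%:R + 1) / 2 * Hr ^+ m = d%:R * ((d%:R + 1) / (2 * d%:R) * Hr ^+ m).
    by field; rewrite lt0r_neq0.
  by rewrite ltr_pM2l.
set T := \tr _ in trE *; set val := Num.max _ _.
have lower r : decomposition_value (ipen adj d p) r -> val <= r.
  exact: decomposition_value_ge.
split=> //.
set F := fidelity d p in F0 rhoE trE; set f := noise d p in f0 rhoE trE.
set m := #|{: edge adj}| in trE.
(* The total weight of the all-[Phi] pattern that the other patterns can absorb. *)
pose s := (d%:R + 1) / (d%:R - 1) * ((F + (d%:R - 1) * f) ^+ m - F ^+ m).
have s0 : 0 <= s.
  apply: mulr_ge0.
    by apply: divr_ge0; [rewrite addr_ge0 ?ler0n ?ler01 | exact: ltW].
  have df0 : 0 <= (d%:R - 1) * f by exact: mulr_ge0 (ltW dB1_gt0) f0.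
  by rewrite subr_ge0 lerXn2r ?nnegrE ?lerDl ?(addr_ge0 F0 df0).
have [t [z [t01 z0 FmE zle]]] : exists t z,
    [/\ 0 <= t <= 1, 0 <= z, F ^+ m = t * s + z
      & z * ((d%:R - 1) / 2) <= val%:C].
  (* If the capacity [s] does not exceed the weight, all of it is used and the remainder costs
     exactly [- T]; otherwise a fraction of it suffices and nothing remains. *)
  have [sF|Fs] := real_leP (ger0_real s0) (ger0_real (exprn_ge0 m F0)).
    exists 1, (F ^+ m - s); split; rewrite ?ler01 ?lexx ?subr_ge0 //.
      by rewrite mul1r subrKC.
    have TE : (F ^+ m - s) * ((d%:R - 1) / 2) = - T.
      by rewrite trE /s; field.
    have Tr : - T \is Num.real.
      by rewrite ger0_real // -TE mulr_ge0 ?subr_ge0 // divr_ge0 ?ler0n ?ltW.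
    rewrite TE -(RRe_real Tr) lecR /val le_max; apply/orP; right.
    by case: (T).
  exists (F ^+ m / s), 0; split=> //.
  - by rewrite divr_ge0 ?exprn_ge0 //= ler_pdivrMr ?mul1r ?ltW // (le_lt_trans _ Fs) ?exprn_ge0.
  - by rewrite addr0 divfK // lt0r_neq0 // (le_lt_trans _ Fs) ?exprn_ge0.
  - by rewrite mul0r ler0c le_max lexx.
have [r rv rle] := isotropic_product_decomposition tree_adj d_ge2 F0 f0 e0
  rhoE st t01 z0 FmE.
suff -> : val = r by [].
by apply: le_anti; rewrite lower //= -lecR (le_trans rle).
Qed.
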